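(* Let $(\mathcal{P},\Omega)$ be a poset equipped with an $\mathbb{R}$-flow. Let $\varepsilon\ge0$ and let $I,J\subset\mathcal{P}$ be $2\varepsilon$-significant intervals such that $I\cap J$ is an interval. Then $C(I),C(J)$ are $\varepsilon$-interleaved if and only if the following four conditions hold: 1. $I\cap J(\varepsilon)$ is $(I,J(\varepsilon))$-valid (equivalently, there exists a nonzero morphism $C(I)\to C(J(\varepsilon))$); 2. $J\cap I(\varepsilon)$ is $(J,I(\varepsilon))$-valid (equivalently, there exists a nonzero morphism $C(J)\to C(I(\varepsilon))$); 3. $\varnothing\neq I\cap I(2\varepsilon)\subset J(\varepsilon)$; 4. $\varnothing\neq J\cap J(2\varepsilon)\subset I(\varepsilon)$.
   Context: $\mathbb{K}$ is a fixed field. A subset $I$ of a poset $\mathcal{P}$ is poset-convex if $p,q\in I$, $r\in\mathcal{P}$, $p\le r\le q$ imply $r\in I$; it is poset-connected if for all $p,q\in I$ there are $r_1,\dots,r_{2n}\in I$ with $p\le r_1\ge r_2\le\cdots\le r_{2n-1}\ge r_{2n}\le q$. An interval is a poset-convex, poset-connected subset (possibly empty). A connected component of a subset $U\subset\mathcal{P}$ is a nonempty poset-connected subset of $U$ that is maximal with respect to inclusion. A $\mathcal{P}$-module is a functor $M$ from $\mathcal{P}$ (viewed as a category with a unique morphism $p\to q$ iff $p\le q$) to $\mathbb{K}$-vector spaces, with structure maps $\varphi_M(p,q)$; morphisms are natural transformations. For an interval $I$, $C(I)$ is the $\mathcal{P}$-module with $C(I)_p=\mathbb{K}$ if $p\in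 I$ and $0$ otherwise, and $\varphi_{C(I)}(p,q)=\mathrm{Id}_{\mathbb{K}}$ if $p,q\in I$ and $0$ otherwise. An $\mathbb{R}$-flow on $\mathcal{P}$ is a family $\Omega=(\Omega_t:\mathcal{P}\to\mathcal{P})_{t\in\mathbb{R}}$ of order-preserving maps with $\Omega_t(p)\le\Omega_s(p)$ for all $t\le s$ and $p\in\mathcal{P}$, $\Omega_{t+s}=\Omega_t\circ\Omega_s$, and $\Omega_0=\mathrm{id}$. For $I\subset\mathcal{P}$, $I(t)=\{p\in\mathcal{P}\mid\Omega_t(p)\in I\}=\Omega_{-t}(I)$. For a module $M$, $M(t)_p=M_{\Omega_t(p)}$, $\varphi_{M(t)}(p,q)=\varphi_M(\Omega_t(p),\Omega_t(q))$, and for a morphism $f$, $f(t)_p=f_{\Omega_t(p)}$; one has $C(I)(t)=C(I(t))$. For $\delta\ge0$, $\varphi_M^\delta:M\to M(\delta)$ is the morphism given at $p$ by $\varphi_M(p,\Omega_\delta(p))$. For $\delta\ge0$, an interval $I$ is $\delta$-trivial if $\varphi^{\delta}_{C(I)}:C(I)\to C(I(\delta))$ is the zero morphism, and $\delta$-significant otherwise. For intervals $A,B\subset\mathcal{P}$, a connected component $Q$ of $A\cap B$ is $(A,B)$-valid if for every $p\in Q$: every $q\in A$ with $q\le p$ lies in $B$, and every $r\in B$ with $r\ge p$ lies in $A$. Modules $M,N$ are $\varepsilon$-interleaved if there are morphisms $f:M\to N(\varepsilon)$, $g:N\to M(\varepsilon)$ with $g(\varepsilon)\circ f=\varphi_M^{2\varepsilon}$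 and $f(\varepsilon)\circ g=\varphi_N^{2\varepsilon}$.
   Formalization: The formal theorem additionally assumes that I∩J(ε) and J∩I(ε) are intervals (that is, connected, possibly empty), as validity of the whole intersection presupposes; with only I∩J an interval the claim is false. *)

(* Defs.v *)
From HB Require Import structures.
From mathcomp Require Import all_boot all_order all_algebra.
From mathcomp Require Import boolp classical_sets reals.

Set Implicit Arguments.
Unset Strict Implicit.
Unset Printing Implicit Defensive.

Import Order.TTheory GRing.Theory Num.Theory.
Local Open Scope classical_set_scope.
Local Open Scope ring_scope.

Section Posets.
Context {d : Order.disp_t} {P : porderType d}.
Implicit Types A B I Q U : set P.

Definition poset_convex I : Prop :=
  forall p q r : P, I p -> I q -> (p <= r)%O -> (r <= q)%O -> I r.

(* The zigzag p <= r_1 >= r_2 <= ... >= r_2n <= q, with p = r_0 and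
   q = r_(2n+1). *)
Definition zigzag I (p q : P) : Prop :=
  exists n : nat, exists r : nat -> P,
    [/\ r 0%N = p, r n.*2.+1 = q,
        forall i, (i <= n.*2.+1)%N -> I (r i)
      & forall i, (i <= n.*2)%N ->
          if odd i then (r i.+1 <= r i)%O else (r i <= r i.+1)%O].

Definition poset_connected I : Prop :=
  forall p q : P, I p -> I q -> zigzag I p q.

Definition is_interval I : Prop := poset_convex I /\ poset_connected I.

Definition connected_component_of U Q : Prop :=
  [/\ Q !=set0, Q `<=` U, poset_connected Q
    & forall Q', Q' `<=` U -> poset_connected Q' -> Q `<=` Q' -> Q' = Q].

(* (A, B)-valid; being a connected component of A `&` B is part of the
   notion. *)
Definition valid A B Q : Prop :=
  connected_component_of (A `&` B) Q /\
  forall p, Q p ->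
    (forall q, A q -> (q <= p)%O -> B q) /\
    (forall r, B r -> (p <= r)%O -> A r).

End Posets.

Record flow (R : realType) (d : Order.disp_t) (P : porderType d) := Flow {
  flow_map :> R -> P -> P;
  flow_homo : forall t, {homo flow_map t : p q / (p <= q)%O};
  flow_le : forall (s t : R) (p : P), s <= t ->
    (flow_map s p <= flow_map t p)%O;
  flowD : forall (t s : R) (p : P),
    flow_map (t + s) p = flow_map t (flow_map s p);
  flow0 : forall p : P, flow_map 0 p = p }.

Section Shift.
Context {R : realType} {d : Order.disp_t} {P : porderType d}.
Variable Om : flow R P.

Definition shift_set (t : R) (I : set P) : set P := [set p | I (Om t p)].

Lemma flowK t : cancel (Om t) (Om (- t)).
Proof. by move=> p; rewrite -flowD addNr flow0. Qed.

Lemma flowNK t : cancel (Om (- t)) (Om t).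
Proof. by move=> p; rewrite -flowD subrr flow0. Qed.

Lemma shift_set_interval (t : R) (I : set P) :
  is_interval I -> is_interval (shift_set t I).
Proof.
move=> [cI nI]; split.
  move=> p q r Ip Iq pr rq.
  by apply: (cI _ _ _ Ip Iq); apply: flow_homo.
move=> p q Ip Iq; have [n [r [r0 rn Ir rP]]] := nI _ _ Ip Iq.
exists n, (fun i => Om (- t) (r i)); split.
- by rewrite r0 flowK.
- by rewrite rn flowK.
- by move=> i ile; rewrite /shift_set /= flowNK; apply: Ir.
- by move=> i /rP; case: ifP => _ h; apply: flow_homo.
Qed.

Lemma le_flow (t : R) (p : P) : 0 <= t -> (p <= Om t p)%O.
Proof. by move=> t0; rewrite -[leLHS](flow0 Om) flow_le. Qed.

End Shift.

Section Modules.
Context {K : fieldType} {d : Order.disp_t} {P : porderType d}.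

Record pmodule := PModule {
  pm_space :> P -> lmodType K;
  pm_map : forall p q : P, (p <= q)%O -> {linear pm_space p -> pm_space q};
  pm_map_id : forall (p : P) (h : (p <= p)%O) x, pm_map h x = x;
  pm_map_comp : forall (p q r : P) (pq : (p <= q)%O) (qr : (q <= r)%O)
    (pr : (p <= r)%O) x, pm_map pr x = pm_map qr (pm_map pq x) }.

Record pmorphism (M N : pmodule) := PMorphism {
  pmor :> forall p : P, {linear M p -> N p};
  pmor_natural : forall (p q : P) (pq : (p <= q)%O) x,
    pmor q (pm_map M pq x) = pm_map N pq (pmor p x) }.

Definition nonzero_morphism (M N : pmodule) (f : pmorphism M N) : Prop :=
  ~ forall p x, f p x = 0.

Lemma le_of_eq (p q : P) : p = q -> (p <= q)%O.
Proof. by move=> ->. Qed.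

(* Identity of M_p = M_q when p = q. *)
Definition pm_cast (M : pmodule) (p q : P) (e : p = q) : {linear M p -> M q} :=
  pm_map M (le_of_eq e).

End Modules.
Arguments pmodule K {d} P.

Section IntervalModule.
Context {K : fieldType} {d : Order.disp_t} {P : porderType d}.

(* 'rV[K]_0 is the zero vector space. *)
Definition ind_space (b : bool) : lmodType K :=
  if b then (K^o : lmodType K) else ('rV[K]_0 : lmodType K).

Definition ind_map (b c : bool) : ind_space b -> ind_space c :=
  match b, c return ind_space b -> ind_space c with
  | true, true => fun x => x
  | _, _ => fun _ => 0
  end.

Lemma ind_map_linear b c : linear (@ind_map b c).
Proof. by case: b c => [] [] k x y //=; rewrite scaler0 addr0. Qed.

HB.instance Definition _ b c :=
  GRing.isLinear.Build K (ind_space b) (ind_space c) _ (@ind_map b c)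
    (@ind_map_linear b c).

Variables (I : set P) (hI : is_interval I).

Let cspace (p : P) : lmodType K := ind_space `[< I p >].

Let cmap (p q : P) (_ : (p <= q)%O) : {linear cspace p -> cspace q} :=
  @ind_map `[< I p >] `[< I q >].

Let cmap_id (p : P) (h : (p <= p)%O) x : cmap h x = x.
Proof.
rewrite /cmap /cspace /= in x *; move: x; case: `[< _ >] => //= x.
by rewrite [x](@thinmx0 K 1).
Qed.

Let cmap_comp (p q r : P) (pq : (p <= q)%O) (qr : (q <= r)%O)
  (pr : (p <= r)%O) x : cmap pr x = cmap qr (cmap pq x).
Proof.
have : `[< I p >] -> `[< I r >] -> `[< I q >].
  by move=> /asboolP Ip /asboolP Ir; apply/asboolP; apply: (hI.1 p r).
rewrite /cmap /cspace /= in x *; move: x.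
by case: `[< I p >]; case: `[< I q >]; case: `[< I r >] => //= x /(_ isT isT).
Qed.

Definition interval_module : pmodule K P := PModule cmap_id cmap_comp.

End IntervalModule.
Arguments interval_module K {d P I} hI.

Section Interleavings.
Context {K : fieldType} {R : realType} {d : Order.disp_t} {P : porderType d}.
Variable Om : flow R P.
Implicit Types M N : pmodule K P.

Definition shift_module (t : R) M : pmodule K P :=
  @PModule K d P (fun p => M (Om t p))
    (fun p q pq => pm_map M (@flow_homo _ _ _ Om t p q pq))
    (fun p h x => pm_map_id _ x)
    (fun p q r pq qr pr x => pm_map_comp _ _ _ x).

Definition shift_morphism (t : R) M N (f : pmorphism M N) :
    pmorphism (shift_module t M) (shift_module t N) :=
  @PMorphism K d P (shift_module t M) (shift_module t N)
    (fun p => f (Om t p))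
    (fun p q pq x => pmor_natural f (@flow_homo _ _ _ Om t p q pq) x).

Lemma transition_natural (t : R) (t0 : 0 <= t) M (p q : P) (pq : (p <= q)%O) x :
  pm_map M (le_flow Om q t0) (pm_map M pq x) =
  pm_map (shift_module t M) pq (pm_map M (le_flow Om p t0) x).
Proof.
have h := le_trans pq (le_flow Om q t0).
by rewrite -(pm_map_comp _ _ h) /= -(pm_map_comp _ _ h).
Qed.

Definition transition (t : R) (t0 : 0 <= t) M :
    pmorphism M (shift_module t M) :=
  @PMorphism K d P M (shift_module t M)
    (fun p => pm_map M (le_flow Om p t0)) (@transition_natural t t0 M).

Lemma flow_double (t : R) (p : P) : Om (2 * t) p = Om t (Om t p).
Proof. by rewrite mulr_natl mulr2n flowD. Qed.

Lemma double_ge0 (t : R) : 0 <= t -> 0 <= 2 * t.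
Proof. by move=> t0; rewrite mulr_ge0. Qed.

(* g(e) \o f = phi_M^(2e).  The codomains M(e)(e) and M(2e) agree only through
   the flow law Om (2e) p = Om e (Om e p), hence the cast. *)
Definition composes_to_transition (e : R) (e0 : 0 <= e) M N
    (f : pmorphism M (shift_module e N)) (g : pmorphism N (shift_module e M)) :
    Prop :=
  forall (p : P) (x : M p),
    shift_morphism e g p (f p x) =
    pm_cast M (flow_double e p) (transition (double_ge0 e0) M p x).

Definition interleaved (e : R) (e0 : 0 <= e) M N : Prop :=
  exists (f : pmorphism M (shift_module e N))
         (g : pmorphism N (shift_module e M)),
    composes_to_transition e0 f g /\ composes_to_transition e0 g f.

End Interleavings.

Section Significant.
Variable K : fieldType.
Context {R : realType} {d : Order.disp_t} {P : porderType d}.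
Variable Om : flow R P.

Definition trivial_interval (t : R) (t0 : 0 <= t) (I : set P)
    (hI : is_interval I) : Prop :=
  forall p x, transition Om t0 (interval_module K hI) p x = 0.

Definition significant_interval (t : R) (t0 : 0 <= t) (I : set P)
    (hI : is_interval I) : Prop :=
  ~ trivial_interval t0 hI.

End Significant.

(* Main.v *)
Require Import Defs.
From mathcomp Require Import all_boot all_order all_algebra.
From mathcomp Require Import boolp classical_sets reals.
Import Order.TTheory GRing.Theory Num.Theory.
Local Open Scope classical_set_scope.
Local Open Scope ring_scope.

(** Each value of an interval module has dimension at most one, so a morphism
    [f : C(A) -> C(B)] is a family of scalars [scal f p], and a nonzero scalar
    at [p] forces [p] to lie in [A `&` B].  Naturality along [p <= q] says that
    [scal f p = scal f q] as soon as [p] is in [A] and [q] is in [B]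
    ([scal_natural]).  Everything about [f] follows from this one rule.  Along
    a zigzag in [A `&` B] it makes the scalar constant, and at a step leaving
    [A `&` B] below through [A] or above through [B] it carries a nonzero
    scalar to the other end of the step, which must therefore lie in
    [A `&` B]: this is validity.  Conversely, validity is what the family of
    scalars equal to 1 on [A `&` B] needs in order to be natural, which gives
    [valid_iff_nonzero_morphism].

    For interleavings, the transition [C(I) -> C(I(2 eps))] is nonzero exactly
    at the points of [I `&` I(2 eps)].  If it factors through [C(J(eps))], these
    points lie in [J(eps)], the first factor is nonzero, and significance of
    [I] provides such a point ([half_interleaving_necessary]).  Conversely,
    valid pairs give morphisms with all scalars 1; their composite has scalar 1
    at the points of [I `&` J(eps) `&` I(2 eps)] and 0 elsewhere, and the
    inclusion [I `&` I(2 eps) `<=` J(eps)] says that this is the transition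
    ([half_interleaving_sufficient]).  An interleaving is two such
    factorizations, with [I] and [J] exchanged. *)

(** * Zero- and one-dimensional spaces *)

Section IndSpace.
Set Implicit Arguments.
Unset Strict Implicit.
Variable K : fieldType.

Definition coord (b : bool) (x : ind_space b) : K := @ind_map K b true x.

(** Being total in [b] (zero when [b] is false), it is preserved by every map
    [ind_map] out of a one-dimensional space, whatever the target. *)
Definition gen (b : bool) : ind_space b := @ind_map K true b 1.

Lemma coord_inj (b : bool) : injective (@coord b).
Proof. by case: b => x y //= _; rewrite [x](@thinmx0 K 1) [y](@thinmx0 K 1). Qed.

Lemma coord0 (b : bool) : coord (0 : ind_space b) = 0.
Proof. by case: b. Qed.

Lemma coord_false (b : bool) (x : ind_space b) : b = false -> coord x = 0.
Proof. by case: b x. Qed.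

Lemma coordZ_gen (b : bool) (x : ind_space b) : x = coord x *: gen b.
Proof.
apply: coord_inj; case: b x => //= x.
by rewrite /coord /gen /= /GRing.scale /= mulr1.
Qed.

Lemma coord_gen (b : bool) : b -> coord (gen b) = 1.
Proof. by case: b. Qed.

Lemma coord_ind_map (b c : bool) (x : ind_space b) :
  c -> coord (@ind_map K b c x) = coord x.
Proof. by case: b c x => [] []. Qed.

Lemma ind_map_gen (b c : bool) : b -> @ind_map K b c (gen b) = gen c.
Proof. by case: b. Qed.

Lemma ind_map_neq0 (b c : bool) (x : ind_space b) :
  @ind_map K b c x <> 0 -> b && c.
Proof. by case: b c x => [] []. Qed.

(** The two sides are the two ways around a square from [a] to [d]; only when
    both corners are one-dimensional do the intermediate spaces matter. *)
Lemma ind_map_square (a b c d : bool) (x : ind_space a) : (a -> d -> b = c) ->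
  @ind_map K b d (@ind_map K a b x) = @ind_map K c d (@ind_map K a c x).
Proof.
by case: a d x => [] [] x; case: b; case: c => // /(_ isT isT).
Qed.

Lemma ind_map_comp (a b c : bool) (x : ind_space a) : (a -> c -> b) ->
  @ind_map K b c (@ind_map K a b x) = @ind_map K a c x.
Proof. by case: a b c x => [] [] [] //= x /(_ isT isT). Qed.

End IndSpace.

(** * Morphisms between interval modules *)

Section IntervalMorphisms.
Set Implicit Arguments.
Unset Strict Implicit.
Variable K : fieldType.
Context {d : Order.disp_t} {P : porderType d}.
Variables (A B : set P) (hA : is_interval A) (hB : is_interval B).
Let CA := interval_module K hA.
Let CB := interval_module K hB.

Definition scal (f : pmorphism CA CB) (p : P) : K :=
  @coord K `[< B p >] (f p (gen K `[< A p >])).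

Lemma scal_nonzero (f : pmorphism CA CB) :
  nonzero_morphism f <-> exists p, scal f p <> 0.
Proof.
split=> [f0|[p sp] f0]; last by apply: sp; rewrite /scal f0 coord0.
apply: contrapT => s0; apply: f0 => p x; rewrite (coordZ_gen x) linearZ /=.
suff -> : f p (gen K `[< A p >]) = 0 by rewrite scaler0.
apply: (@coord_inj K `[< B p >]); rewrite coord0.
by apply: contrapT => sp; apply: s0; exists p.
Qed.

Lemma scal_support (f : pmorphism CA CB) p : scal f p <> 0 -> (A `&` B) p.
Proof.
rewrite /scal => sp; split; apply: contrapT => /asboolPn/negPf np; apply: sp.
  have -> : gen K `[< A p >] = 0 by rewrite np.
  by rewrite linear0 coord0.
exact: coord_false.
Qed.

(** Compare both sides of the naturality square on the generator at [p]:
    [C(A)] sends it to the generator at [q] (to zero if [q] is outside [A], as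
    is the generator), and [C(B)] preserves coordinates since [q] is in [B]. *)
Lemma scal_natural (f : pmorphism CA CB) p q :
  (p <= q)%O -> A p -> B q -> scal f p = scal f q.
Proof.
move=> pq /asboolP Ap /asboolP Bq.
have /(congr1 (@coord K `[< B q >])) := pmor_natural f pq (gen K `[< A p >]).
rewrite /= (ind_map_gen _ _ Ap) /scal => ->.
by rewrite (coord_ind_map _ Bq).
Qed.

Lemma scal_zigzag (f : pmorphism CA CB) p q :
  zigzag (A `&` B) p q -> scal f p = scal f q.
Proof.
move=> [n [r [<- <- rAB rP]]].
suff H i : (i <= n.*2.+1)%N -> scal f (r 0%N) = scal f (r i) by exact: H.
elim: i => // i IH lei; rewrite IH 1?ltnW //.
have [Ai Bi] := rAB i (ltnW lei); have [Aj Bj] := rAB _ lei.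
by have := rP i lei; case: odd => h; [symmetry|]; apply: scal_natural.
Qed.

Section OfValid.
Hypothesis vAB : valid A B (A `&` B).

(** If [p <= q] with [p] in [A] and [q] in [B], the two halves of validity say
    that [q] is in [A] iff [p] is in [B]: both paths around the naturality
    square are the identity, or both are zero. *)
Lemma valid_natural (p q : P) (pq : (p <= q)%O) (x : CA p) :
  @ind_map K `[< A q >] `[< B q >] (pm_map CA pq x) =
  pm_map CB pq (@ind_map K `[< A p >] `[< B p >] x).
Proof.
apply: ind_map_square => /asboolP Ap /asboolP Bq.
apply: asbool_equiv_eq; split=> [Aq|Bp].
  by apply: (vAB.2 q _).1 pq.
by apply: (vAB.2 p _).2 pq.
Qed.

Definition valid_morphism : pmorphism CA CB :=
  @PMorphism K d P CA CB (fun p => @ind_map K `[< A p >] `[< B p >])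
    valid_natural.

End OfValid.

Lemma connected_is_component (U : set P) :
  U !=set0 -> poset_connected U -> connected_component_of U U.
Proof. by move=> U0 cU; split=> // Q QU _ UQ; apply/seteqP. Qed.

Lemma valid_iff_nonzero_morphism : poset_connected (A `&` B) ->
  valid A B (A `&` B) <-> exists f : pmorphism CA CB, nonzero_morphism f.
Proof.
move=> cAB; split=> [v|[f /scal_nonzero[p0 sp0]]].
  exists (valid_morphism v); apply/scal_nonzero.
  have [[[p [Ap Bp]] _ _ _] _] := v; exists p.
  rewrite /scal /= ind_map_gen; last exact/asboolP.
  by rewrite coord_gen; [apply/eqP/oner_neq0|exact/asboolP].
have Q0 := scal_support sp0.
split; first by apply: connected_is_component => //; exists p0.
move=> p Qp; have sp : scal f p <> 0.
  by rewrite -(scal_zigzag f (cAB _ _ Q0 Qp)).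
split=> [q Aq qp|r Br pr].
  by apply: (@scal_support f q _).2; rewrite (scal_natural f qp) //; case: Qp.
by apply: (@scal_support f r _).1; rewrite -(scal_natural f pr) //; case: Qp.
Qed.

End IntervalMorphisms.

(** * Interleavings of interval modules *)

Section HalfInterleaving.
Set Implicit Arguments.
Unset Strict Implicit.
Variable K : fieldType.
Context {R : realType} {d : Order.disp_t} {P : porderType d}.
Variables (Om : flow R P) (e : R) (e0 : 0 <= e).

(** [C(J)(e)] and [C(J(e))] have the same spaces and maps, and differ only in
    the proofs of the functor laws. *)
Definition to_shift (J : set P) (hJ : is_interval J) (M : pmodule K P)
    (f : pmorphism M (interval_module K (shift_set_interval Om e hJ))) :
    pmorphism M (shift_module Om e (interval_module K hJ)) :=
  @PMorphism K d P M (shift_module Om e (interval_module K hJ))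
    (fun p => f p) (fun p q pq x => pmor_natural f pq x).

Definition of_shift (J : set P) (hJ : is_interval J) (M : pmodule K P)
    (f : pmorphism M (shift_module Om e (interval_module K hJ))) :
    pmorphism M (interval_module K (shift_set_interval Om e hJ)) :=
  @PMorphism K d P M (interval_module K (shift_set_interval Om e hJ))
    (fun p => f p) (fun p q pq x => pmor_natural f pq x).

Variables (I J : set P) (hI : is_interval I) (hJ : is_interval J).
Let CI := interval_module K hI.
Let CJ := interval_module K hJ.

(** Both steps are structure maps of [C(I)], so by functoriality the cast
    disappears into a single map from [p] to [Om e (Om e p)]. *)
Lemma cast_transition p (x : CI p) :
  pm_cast CI (flow_double Om e p) (transition Om (double_ge0 e0) CI p x) =
  @ind_map K `[< I p >] `[< I (Om e (Om e p)) >] x.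
Proof. by apply: ind_map_comp => _; rewrite flow_double. Qed.

Lemma significant_meets_shift :
  significant_interval K Om (double_ge0 e0) hI ->
  I `&` shift_set Om (2 * e) I !=set0.
Proof.
move=> sig; apply: contrapT => I0; apply: sig => p x; apply: contrapT.
by move=> /ind_map_neq0/andP[/asboolP Ip /asboolP Iq]; apply: I0; exists p.
Qed.

(** At a point of [I `&` I(2e)] the composite is the identity of a line, so it
    cannot factor through zero: the scalar of [f] is nonzero there. *)
Lemma half_interleaving_necessary
    (f : pmorphism CI (shift_module Om e CJ))
    (g : pmorphism CJ (shift_module Om e CI)) :
  significant_interval K Om (double_ge0 e0) hI ->
  composes_to_transition e0 f g ->
  [/\ nonzero_morphism (of_shift f),
      I `&` shift_set Om (2 * e) I !=set0
    & I `&` shift_set Om (2 * e) I `<=` shift_set Om e J].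
Proof.
move=> sig fg.
have sf p : (I `&` shift_set Om (2 * e) I) p ->
    scal (of_shift f) p <> 0.
  move=> [Ip]; rewrite /shift_set /= flow_double => Iq s0.
  have /= := fg p (gen K `[< I p >]); rewrite cast_transition.
  have -> : f p (gen K `[< I p >]) = 0.
    by apply: (@coord_inj K `[< J (Om e p) >]); rewrite coord0.
  rewrite linear0 ind_map_gen; last exact/asboolP.
  move=> /(congr1 (@coord K `[< I (Om e (Om e p)) >])).
  rewrite coord0 coord_gen; last exact/asboolP.
  by move=> /esym/eqP; rewrite oner_eq0.
have I0 := significant_meets_shift sig.
split=> //; last by move=> p Ip; have [] := scal_support (sf p Ip).
by apply/scal_nonzero; have [p /sf] := I0; exists p.
Qed.

(** At a point of [I `&` I(2e)] the middle space of the composite is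
    one-dimensional by hypothesis, hence the composite is the identity; at the
    other points both sides have a zero source or target. *)
Lemma half_interleaving_sufficient
    (vIJ : valid I (shift_set Om e J) (I `&` shift_set Om e J))
    (vJI : valid J (shift_set Om e I) (J `&` shift_set Om e I)) :
  I `&` shift_set Om (2 * e) I `<=` shift_set Om e J ->
  composes_to_transition e0
    (to_shift (valid_morphism K hI (shift_set_interval Om e hJ) vIJ))
    (to_shift (valid_morphism K hJ (shift_set_interval Om e hI) vJI)).
Proof.
move=> sub p x; rewrite cast_transition; apply: ind_map_comp.
move=> /asboolP Ip /asboolP Iq; apply/asboolP/sub; split=> //.
by rewrite /shift_set /= flow_double.
Qed.

End HalfInterleaving.

Theorem proposition5p8
  (K : fieldType) (R : realType) (d : Order.disp_t) (P : porderType d)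
  (Om : flow R P) (eps : R) (eps_ge0 : 0 <= eps)
  (I J : set P) (hI : is_interval I) (hJ : is_interval J)
  (sigI : significant_interval K Om (double_ge0 eps_ge0) hI)
  (sigJ : significant_interval K Om (double_ge0 eps_ge0) hJ)
  (hIJ : is_interval (I `&` J))
  (hIJeps : is_interval (I `&` shift_set Om eps J))
  (hJIeps : is_interval (J `&` shift_set Om eps I)) :
  (interleaved Om eps_ge0 (interval_module K hI) (interval_module K hJ) <->
   [/\ valid I (shift_set Om eps J) (I `&` shift_set Om eps J),
       valid J (shift_set Om eps I) (J `&` shift_set Om eps I),
       I `&` shift_set Om (2 * eps) I !=set0 /\
       I `&` shift_set Om (2 * eps) I `<=` shift_set Om eps J
     & J `&` shift_set Om (2 * eps) J !=set0 /\
       J `&` shift_set Om (2 * eps) J `<=` shift_set Om eps I]) /\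
  (valid I (shift_set Om eps J) (I `&` shift_set Om eps J) <->
   exists f : pmorphism (interval_module K hI)
                (interval_module K (shift_set_interval Om eps hJ)),
     nonzero_morphism f) /\
  (valid J (shift_set Om eps I) (J `&` shift_set Om eps I) <->
   exists g : pmorphism (interval_module K hJ)
                (interval_module K (shift_set_interval Om eps hI)),
     nonzero_morphism g).
Proof.
have vIJ := valid_iff_nonzero_morphism
  K hI (shift_set_interval Om eps hJ) hIJeps.2.
have vJI := valid_iff_nonzero_morphism
  K hJ (shift_set_interval Om eps hI) hJIeps.2.
split; last by split.
split=> [[f [g [fg gf]]]|[v w [_ subI] [_ subJ]]].
  have [nf ? ?] := half_interleaving_necessary sigI fg.
  have [ng ? ?] := half_interleaving_necessary sigJ gf.
  by split=> //; [apply/vIJ; eexists; exact: nf|apply/vJI; eexists; exact: ng].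
exists (to_shift (valid_morphism K hI (shift_set_interval Om eps hJ) v)).
exists (to_shift (valid_morphism K hJ (shift_set_interval Om eps hI) w)); split.
  exact: half_interleaving_sufficient.
exact: half_interleaving_sufficient.
Qed.
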